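(* Let $G=(V,E)$ be a locally finite, connected graph with graph metric $d$. Then the $L^1$-compression exponent $\alpha_1^*(G)$ equals the supremum over those $\alpha\in[0,1]$ for which there exists $C>0$ such that for every $p<1$ there exists a general bond percolation $\mathbf{P}$ on $G$, with configuration denoted $\omega$, such that $\mathbf{P}[e\in\omega]>p$ for every $e\in E$ and such that, for some $\beta,\gamma>0$ with $\beta/\gamma\le C$, $$e^{-\beta d(u,v)}\ \le\ \mathbf{P}[u\leftrightarrow v]\ \le\ e^{-\gamma d(u,v)^\alpha}\qquad\text{for every } u,v\in V .$$
   Context: Graphs have a vertex set $V$ and a set $E$ of undirected edges. A graph is locally finite if every vertex has finite degree. For a connected graph, $d(u,v)$ is the length of a shortest path joining $u$ and $v$. The $L^1$-compression exponent $\alpha_1^*(X)$ of a metric space $(X,d_X)$ is the supremum over all $\alpha\in[0,1]$ such that there exist a measure space $(Y,\nu)$, a Lipschitz function $f\colon X\to L^1(\nu)$ and a constant $c>0$ with $\|f(u)-f(v)\|_1\ge c\,d_X(u,v)^\alpha$ for every $u,v\in X$. For a graph, $\alpha_1^*(G):=\alpha_1^*((V,d))$. In the case $\alpha=0$ the convention $0^0:=0$ is used, so that pairs with $u=v$ impose no restriction. A general bond percolation on $G$ is a probability measure $\mathbf{P}$ on subsets of $E$, i.e. on $\{0,1\}^E$ with its Borel $\sigma$-algebra (no invariance or independence is assumed). The configuration $\omega\subset E$ is identified with the induced subgraph with vertex set $V$ and edge set $\omega$; its connected components are called clusters, and $\{u\leftrightarrow v\}$ is the event that $u$ and $v$ lie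 in the same cluster of $\omega$. *)

(* Defs.v *)
From HB Require Import structures.
From mathcomp Require Import all_boot all_order all_algebra.
From mathcomp Require Import all_classical all_reals all_analysis.
Set Implicit Arguments.
Unset Strict Implicit.
Unset Printing Implicit Defensive.
Import Order.TTheory GRing.Theory Num.Theory.
Import numFieldNormedType.Exports.
Local Open Scope classical_set_scope.
Local Open Scope ring_scope.

(* Loops and parallel edges are allowed; a simple graph is the case where
   [ends] is injective and every [ends e] has two elements. *)
Record graph := Graph {
  vertex : Type;
  edge : Type;
  ends : edge -> set vertex;
  endsP : forall e, exists u v, ends e = [set u; v]
}.

Section Graph.
Variable G : graph.
Implicit Types (u v : vertex G) (S : set (edge G)).

Definition locally_finite := forall v, finite_set [set e : edge G | ends e v].

(* For a set of edges S, these refer to the spanning subgraph with edge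
   set S; the graph G itself is the case S = setT. *)
Definition neighbours S u v := exists2 e, S e & ends e = [set u; v].

Definition walk S (n : nat) u v :=
  exists p : seq (vertex G),
    [/\ path (fun x y => `[< neighbours S x y >]) u p, last u p = v & size p = n].

Definition joined S u v := exists n, walk S n u v.

Definition connected_graph := forall u v, joined setT u v.

(* The default value 0 is never used when G is connected. *)
Definition gdist u v : nat :=
  if pselect (exists n, `[< walk setT n u v >]) is left uv
  then ex_minn uv else 0%N.

(* {0,1}^E with the Borel sigma-algebra of its product topology. *)
Definition config := g_sigma_algebraType (@open {ptws edge G -> bool}).

Definition open_edges (w : config) : set (edge G) := [set e | w e].

End Graph.

(* x `^ a with the convention 0 `^ 0 = 0. *)
Definition pow0 (R : realType) (x a : R) : R := if x == 0 then 0 else x `^ a.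

(* Elements of L^1(nu) are a.e. classes, coerced to a representative; the norm
   does not depend on which one. *)
Definition L1dist d (Y : measurableType d) (R : realType)
    (nu : {measure set Y -> \bar R}) (f g : LspaceType1 nu) : \bar R :=
  'N[nu]_1 [EFin \o (f \- g)].

Definition L1_compressible (R : realType) (X : Type) (dX : X -> X -> R)
    (a : R) : Prop :=
  exists (d : measure_display) (Y : measurableType d)
      (nu : {measure set Y -> \bar R}) (f : X -> LspaceType1 nu),
    (exists L : R, forall u v, (L1dist (f u) (f v) <= (L * dX u v)%:E)%E) /\
    (exists2 c : R, 0 < c &
      forall u v, ((c * pow0 (dX u v) a)%:E <= L1dist (f u) (f v))%E).

Definition L1_compression_exponent (R : realType) (X : Type)
    (dX : X -> X -> R) : R :=
  sup [set a | 0 <= a <= 1 /\ L1_compressible dX a].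

Definition graph_L1_compression_exponent (R : realType) (G : graph) : R :=
  L1_compression_exponent (fun u v : vertex G => (gdist u v)%:R : R).

(* Main.v *)
From HB Require Import structures.
Require Import Defs.
From mathcomp Require Import all_boot all_order all_algebra.
From mathcomp Require Import all_classical all_reals all_analysis.
From mathcomp Require Import measurable_realfun lra ring.
Set Implicit Arguments.
Unset Strict Implicit.
Unset Printing Implicit Defensive.
Import Order.TTheory GRing.Theory Num.Theory.
Import numFieldNormedType.Exports.
Local Open Scope classical_set_scope.
Local Open Scope ring_scope.

(** The two suprema agree because L^1 metrics and the separation probabilities
    of percolations both come from measures on cuts of the vertex set.

    From an embedding to percolations. Let [f] be a Lipschitz map from the
    vertices to [L^1(nu)]. A point [(y, t)] of [Y * R] cuts the vertices into
    those with [f u y <= t] and the others, and the cuts that separate [u] from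
    [v] form a set, the wall between [u] and [v], of measure [|f u - f v|_1]
    ([epigraph_wall_measure]). Take a Poisson process of cuts with intensity
    [eps] times this measure, and close each edge whose ends are separated by a
    cut of the process. A wall contains no point of the process with
    probability [expR (- eps |f u - f v|_1)], so each edge is open with
    probability close to 1 when [eps] is small. An open path from [u] to [v]
    forces the wall between [u] and [v] to be void, since this wall is covered
    by the walls along the path: this is the upper bound. The lower bound is
    the probability that all walls along a geodesic are void. Both rates are
    proportional to [eps], hence their ratio stays bounded
    ([wall_percolation], [percolation_of_compressible]).

    Only the void events of countably many walls matter, so the Poisson process
    itself is not constructed. Its void probabilities [X |-> expR (- mu X)]
    determine the joint law of the void events by inclusion and exclusion; what
    has to be shown is that the numbers so obtained are nonnegative
    ([altdiff_expRN_measure_ge0]), and then Lebesgue measure on [[0, 1[] carries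
    events with this joint law ([exists_random_sets]).

    From percolations to an embedding. For one percolation [P], the probability
    that [u] and [v] lie in different clusters is half the L^1 distance between
    two indicators on the random set of clusters, that of the cluster of [u] and
    that of the cluster of [v]. Take percolations [P n] with exponent [a], edge
    probabilities above [expR (- 2 ^- n)] and rates [beta n], [gamma n]; then
    [gamma n < 2 ^- n] as soon as some edge has distinct ends. After division by [gamma n], the [n]-th distance is at most [C d] and, where
    [2 ^ n] is comparable with [d `^ a], at least of order [d `^ a]. With the
    summable weights [r ^+ n], [r = 2 `^ (- delta)], the sum over [n] of these
    distances is Lipschitz, and the weight of the scale [2 ^ n ~ d `^ a] costs
    only a factor [d `^ (- a delta)]. This gives a compression exponent
    [a (1 - delta)] for every [delta > 0]
    ([percolation_embedding], [compressible_of_percolation]), which is enough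
    for the suprema. *)

(** * Completely monotone set functions *)

Section alternating_differences.
Context (R : realType) (T : Type).
Implicit Types (f g : set T -> R) (B : seq (set T)) (X W : set T).

(** If [f X] is the probability that a random set avoids [X], this is the
    probability that it avoids [X] and meets every member of [B]. *)
Fixpoint altdiff f B X : R :=
  if B is W :: B' then altdiff f B' X - altdiff f B' (X `|` W) else f X.

Lemma altdiff_lin f g c B X :
  altdiff (fun Y => c * f Y + g Y) B X = c * altdiff f B X + altdiff g B X.
Proof. by elim: B X => //= W B IH X; rewrite !IH; ring. Qed.

Lemma altdiffZ f c B X : altdiff (fun Y => c * f Y) B X = c * altdiff f B X.
Proof. by elim: B X => //= W B IH X; rewrite !IH; ring. Qed.

Lemma altdiff_shift f W B X :
  altdiff (fun Y => f (Y `|` W)) B X = altdiff f B (X `|` W).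
Proof. by elim: B X => //= V B IH X; rewrite !IH setUAC. Qed.

Lemma altdiff_local f g (P : set (set T)) B X :
    setU_closed P -> (forall Y, P Y -> f Y = g Y) ->
    P X -> (forall W, W \in B -> P W) ->
  altdiff f B X = altdiff g B X.
Proof.
move=> PU fg; elim: B X => [|W B IH] X PX PB /=; first exact: fg.
have PB' V : V \in B -> P V by move=> VB; apply: PB; rewrite inE VB orbT.
by rewrite !IH//; apply: PU => //; apply: PB; rewrite mem_head.
Qed.

Lemma altdiff_cvg (F : nat -> set T -> R) f B X :
  (forall Y, F n Y @[n --> \oo] --> f Y) ->
  altdiff (F n) B X @[n --> \oo] --> altdiff f B X.
Proof. by move=> Ff; elim: B X => //= W B IH X; exact: cvgB. Qed.

(** A random set cannot avoid [X] and meet a part of [X]. *)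
Lemma altdiff_eq0 f B X W : W \in B -> W `<=` X -> altdiff f B X = 0.
Proof.
elim: B X => //= V B IH X; rewrite inE => /predU1P[<-|WB] WX.
  by rewrite (setUidl WX) subrr.
by rewrite !IH ?subrr//; exact: subset_trans WX (@subsetUl _ _ _).
Qed.

End alternating_differences.

Section completely_monotone.
Context (R : realType) d (T : measurableType d).
Implicit Types (f g : set T -> R) (B : seq (set T)) (X W : set T).

Definition measurables B := forall W, W \in B -> measurable W.

Lemma measurables_cons W B :
  measurables (W :: B) -> measurable W /\ measurables B.
Proof.
move=> mB; split; first by apply: mB; rewrite mem_head.
by move=> V VB; apply: mB; rewrite inE VB orbT.
Qed.

Definition completely_monotone f := forall B X,
  measurables B -> measurable X -> 0 <= altdiff f B X.

Lemma completely_monotone_shift f W : measurable W ->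
  completely_monotone f -> completely_monotone (fun X => f (X `|` W)).
Proof.
move=> mW fm B X mB mX; rewrite altdiff_shift.
by apply: fm => //; exact: measurableU.
Qed.

Lemma completely_monotone_diff f W : measurable W ->
  completely_monotone f ->
  completely_monotone (fun X => f X - f (X `|` W)).
Proof.
move=> mW fm B X mB mX.
have := fm (W :: B) X; rewrite /= => {}fm.
have -> : (fun X => f X - f (X `|` W)) =
    (fun X => (-1) * f (X `|` W) + f X).
  by apply/funext => Y; rewrite mulN1r addrC.
rewrite altdiff_lin altdiff_shift mulN1r addrC; apply: fm => //.
by move=> V; rewrite inE => /predU1P[->|/mB].
Qed.

Lemma completely_monotone_lin f g c : 0 <= c ->
  completely_monotone f -> completely_monotone g ->
  completely_monotone (fun X => c * f X + g X).
Proof.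
move=> c0 fm gm B X mB mX; rewrite altdiff_lin.
by rewrite addr_ge0 ?mulr_ge0 ?fm ?gm.
Qed.

Lemma completely_monotone_cst c : 0 <= c ->
  completely_monotone (fun=> c).
Proof.
move=> c0 B X _ _; case: B => //= W B.
suff H Y : altdiff (fun=> c) B Y = altdiff (fun=> c) B X by rewrite H subrr.
by elim: B X Y => //= V B IH X Y; rewrite (IH Y X) (IH (Y `|` V) (X `|` V)).
Qed.

(** Multiplication of void probabilities corresponds to the union of independent
    random sets. *)
Lemma completely_monotoneM f g :
  completely_monotone f -> completely_monotone g ->
  completely_monotone (fun X => f X * g X).
Proof.
move=> fm gm B; elim: B f g fm gm => [|W B IH] f g fm gm X mB mX /=.
  by rewrite mulr_ge0// (fm [::] X, gm [::] X).
have [mW mB'] := measurables_cons mB.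
(* Leibniz rule: the difference of a product is a sum of products of
   differences and shifts of the factors, to which the induction hypothesis
   applies. *)
have -> : altdiff (fun Y => f Y * g Y) B X -
    altdiff (fun Y => f Y * g Y) B (X `|` W) =
  altdiff (fun Y => f Y * (g Y - g (Y `|` W))) B X +
  altdiff (fun Y => (f Y - f (Y `|` W)) * g (Y `|` W)) B X.
  rewrite -(altdiff_shift (fun Y => f Y * g Y)) -[X in _ - X]mul1r addrC -mulNr.
  rewrite -altdiff_lin -[altdiff _ _ _ in RHS]mul1r -altdiff_lin.
  by congr altdiff; apply/funext => Y; ring.
apply: addr_ge0; apply: IH => //; first exact: completely_monotone_diff.
  exact: completely_monotone_diff.
exact: completely_monotone_shift.
Qed.

(** The exponential is a limit of polynomials with nonnegative coefficients. *)
Lemma completely_monotone_expR f :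
  completely_monotone f -> completely_monotone (fun X => expR (f X)).
Proof.
move=> fm.
have fXm k : completely_monotone (fun X => f X ^+ k).
  elim: k => [|k IH].
    by under [X in completely_monotone X]eq_fun do rewrite expr0;
      exact: completely_monotone_cst.
  under [X in completely_monotone X]eq_fun do rewrite exprS.
  exact: completely_monotoneM.
have Sm n : completely_monotone (fun X => series (exp_coeff (f X)) n).
  elim: n => [|n IH].
    under [X in completely_monotone X]eq_fun
      do rewrite /series /= big_geq//.
    exact: completely_monotone_cst.
  have -> : (fun X => series (exp_coeff (f X)) n.+1) =
      (fun X => (n`!%:R)^-1 * f X ^+ n + series (exp_coeff (f X)) n).
    apply/funext => X; rewrite /series/= big_nat_recr//= addrC.
    by rewrite /exp_coeff mulrC.
  by apply: completely_monotone_lin => //; rewrite invr_ge0.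
move=> B X mB mX.
have cv : altdiff (fun Y => series (exp_coeff (f Y)) n) B X @[n --> \oo]
    --> altdiff (fun Y => expR (f Y)) B X.
  apply: (altdiff_cvg (F := fun n Y => series (exp_coeff (f Y)) n)) => Y.
  exact: is_cvg_series_exp_coeff.
rewrite -(cvg_lim _ cv)//; apply: limr_ge.
  by apply/cvg_ex; eexists; exact: cv.
by near=> n; exact: Sm.
Unshelve. all: by end_near. Qed.

Context (mu : {measure set T -> \bar R}).

(** The alternating difference over [B] is the measure of the points of [Z]
    outside [X] that lie in every member of [B]. *)
Lemma completely_monotone_setD Z : measurable Z -> (mu Z < +oo)%E ->
  completely_monotone (fun X => fine (mu (Z `\` X))).
Proof.
move=> mZ Zoo B X mB mX.
suff -> : altdiff (fun X => fine (mu (Z `\` X))) B X =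
    fine (mu ((Z `\` X) `&` \big[setI/setT]_(b <- B) b)).
  by rewrite fine_ge0.
elim: B X mB mX => [|W B IH] X mB mX /=; first by rewrite big_nil setIT.
have [mW mB'] := measurables_cons mB.
have mI : measurable (\big[setI/setT]_(b <- B) b).
  by rewrite big_seq; apply: big_ind => // *; exact: measurableI.
have mZX Y : measurable Y ->
    measurable ((Z `\` Y) `&` \big[setI/setT]_(b <- B) b).
  by move=> mY; apply: measurableI => //; exact: measurableD.
have fZX Y : measurable Y ->
    mu ((Z `\` Y) `&` \big[setI/setT]_(b <- B) b) \is a fin_num.
  move=> mY; rewrite ge0_fin_numE//; apply: le_lt_trans Zoo.
  by apply: le_measure; rewrite ?inE//; [exact: mZX|move=> x [] []].
have mXW : measurable (X `|` W) by exact: measurableU.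
rewrite !IH// big_cons -fineB ?fZX//; congr fine.
set I := \big[setI/setT]_(b <- B) b in mI mZX fZX *.
have -> : (Z `\` (X `|` W)) `&` I =
    ((Z `\` X) `&` I) `&` ((Z `\` (X `|` W)) `&` I).
  apply/esym/setIidr => x [[Zx nXWx] Ix]; split => //; split => // Xx.
  by apply: nXWx; left.
rewrite -measureD//; [|exact: mZX|exact: mZX|by rewrite -ge0_fin_numE// fZX].
congr (mu _); apply/seteqP; split => x /=.
  move=> [[[Zx nXx] Ix] H]; do !split => //.
  by apply: contrapT => nWx; apply: H; split => //; split => // -[].
by move=> [[Zx nXx] [Wx Ix]]; split => // -[[_ H] _]; apply: H; right.
Qed.

(** All sets that occur lie in one set [Z] of finite measure, and there
    [expR (- mu Y) = expR (- mu Z) * expR (mu (Z `\` Y))], where the last factor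
    is the exponential of a completely monotone function. *)
Lemma altdiff_expRN_measure_ge0 B X :
    measurables B -> (forall W, W \in B -> mu W < +oo)%E ->
    measurable X -> (mu X < +oo)%E ->
  0 <= altdiff (fun Y => expR (- fine (mu Y))) B X.
Proof.
move=> mB Boo mX Xoo.
pose Z := X `|` \big[setU/set0]_(W <- B) W.
have [mZ' Zoo'] : measurable (\big[setU/set0]_(W <- B) W) /\
    (mu (\big[setU/set0]_(W <- B) W) < +oo)%E.
  rewrite big_seq; apply: (big_ind (fun W => measurable W /\ (mu W < +oo)%E)).
  - by rewrite measure0.
  - move=> V W [mV Voo] [mW Woo]; split; first exact: measurableU.
    by rewrite (le_lt_trans (measureU2 _ _ _))// lte_add_pinfty.
  - by move=> W WB; split; [exact: mB|exact: Boo].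
have mZ : measurable Z by exact: measurableU.
have Zoo : (mu Z < +oo)%E.
  by rewrite (le_lt_trans (measureU2 _ _ _))// lte_add_pinfty.
rewrite (@altdiff_local _ _ _ (fun Y => expR (- fine (mu Z)) *
  expR (fine (mu (Z `\` Y)))) (fun Y => measurable Y /\ Y `<=` Z)).
- rewrite altdiffZ mulr_ge0 ?expR_ge0//.
  by apply: completely_monotone_expR => //; exact: completely_monotone_setD.
- move=> V W [mV VZ] [mW WZ]; split; first exact: measurableU.
  by rewrite subUset.
- move=> Y [mY YZ]; rewrite -expRD; congr expR.
  rewrite measureD// (setIidr YZ) fineB.
  + by rewrite addrA addNr add0r.
  + by rewrite ge0_fin_numE.
  + by rewrite ge0_fin_numE// (le_lt_trans _ Zoo)// le_measure// inE.
- by split => // x; left.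
- move=> W WB; split; first exact: mB.
  by move=> x Wx; right; rewrite -bigcup_seq; exists W.
Qed.

End completely_monotone.

(** * Random bits with prescribed cylinder probabilities *)

Section unit_interval.
Variable R : realType.

Definition lebesgue01 : set (measurableTypeR R) -> \bar R :=
  mrestr lebesgue_measure (measurable_itv `[0%R, 1%R[).

HB.instance Definition _ := Measure.on lebesgue01.

Lemma lebesgue01T : lebesgue01 setT = 1%E.
Proof.
by rewrite /lebesgue01 /mrestr setTI lebesgue_measure_itv/= lte01 sube0.
Qed.

HB.instance Definition _ :=
  Measure_isProbability.Build _ _ _ lebesgue01 lebesgue01T.

End unit_interval.

(** A consistent family [q] of cylinder probabilities on infinite bit sequences
    is realised on [[0, 1[] by nested intervals: the interval of a finite
    sequence is cut in two, in proportion to the probabilities of the two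
    continuations. Bit sequences are listed with the last bit first, so that
    [b :: s] continues [s]. *)
Section interval_splitting.
Variables (R : realType) (q : seq bool -> R).
Hypothesis q_nil : q [::] = 1.
Hypothesis q_ge0 : forall s, 0 <= q s.
Hypothesis q_split : forall s, q s = q (true :: s) + q (false :: s).

Fixpoint lower s : R :=
  if s is b :: s' then lower s' + (if b then 0 else q (true :: s')) else 0.

Fixpoint bits n (t : R) : seq bool :=
  if n is n'.+1 then (t < lower (bits n' t) + q (true :: bits n' t)) :: bits n' t
  else [::].

Lemma size_bits n t : size (bits n t) = n.
Proof. by elim: n => //= n ->. Qed.

Definition cell s : set R := [set t | 0 <= t < 1 /\ bits (size s) t = s].

Lemma cellE s : cell s = `[lower s, lower s + q s[%classic.
Proof.
elim: s => [|b s IH].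
  by apply/seteqP; split => t; rewrite /cell/= in_itv/= q_nil add0r // => -[].
have -> : cell (b :: s) =
    [set t | cell s t /\ (t < lower s + q (true :: s)) = b].
  apply/seteqP; split=> t /=.
    by case=> t01 [<- ts]; rewrite /cell/= ts.
  by case=> -[t01 ts] <-; split => //=; rewrite ts.
rewrite IH; apply/seteqP; split=> t /=; rewrite !in_itv/=.
  case=> /andP[ts1 ts2]; case: b => [|/negbT]; first by rewrite addr0 ts1.
  by rewrite -leNgt => ->/=; rewrite -addrA -q_split.
have := q_ge0 (true :: s); have := q_ge0 (false :: s); have := q_split s.
case: b; rewrite ?addr0 => qs q0 q1 /andP[t1 t2]; split => //.
- by rewrite t1/= (lt_le_trans t2)// lerD2l qs lerDl.
- by rewrite (le_trans _ t1) ?lerDl// qs addrA.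
- by apply/negbTE; rewrite -leNgt.
Qed.

Lemma measurable_cell s : measurable (cell s : set (measurableTypeR R)).
Proof. by rewrite cellE. Qed.

Lemma lebesgue01_cell s : lebesgue01 (cell s) = (q s)%:E.
Proof.
rewrite /lebesgue01 /mrestr setIidl; last first.
  by move=> t [t01 _] /=; rewrite in_itv.
rewrite cellE lebesgue_measure_itv/= lte_fin; case: ifPn.
  by rewrite -EFinD addrAC subrr add0r.
rewrite -leNgt gerDl => q0; congr EFin; apply/eqP.
by rewrite eq_le q_ge0.
Qed.

Definition bit i : set R := [set t | 0 <= t < 1 /\ head false (bits i.+1 t)].

Lemma bits_bit n i t : 0 <= t < 1 -> (i < n)%N ->
  nth false (rev (bits n t)) i <-> bit i t.
Proof.
move=> t01; elim: n => // n IH; rewrite ltnS leq_eqVlt => /predU1P[->|lin].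
  rewrite [bits n.+1 t]/= rev_cons nth_rcons size_rev size_bits ltnn eqxx.
  by rewrite /bit/=; split => [|[]].
by rewrite /= rev_cons nth_rcons size_rev size_bits lin IH.
Qed.

Lemma measurable_bit i : measurable (bit i : set (measurableTypeR R)).
Proof.
have -> : bit i = \bigcup_(s in [set s | size s = i]) cell (true :: s).
  apply/seteqP; split => [t [t01 /= h]|t [s /= <-]].
    by exists (bits i t); rewrite /= ?size_bits//; split; rewrite //= size_bits h.
  by case=> t01 /= [h1 h2]; split => //=.
rewrite bigcup_mkcond; apply: countable_bigcupT_measurable => [|s].
  exact: countableP.
by case: ifP => // _; exact: measurable_cell.
Qed.

End interval_splitting.

(** * Void events of a Poisson process *)

(** Bit [i] records whether the set [W i] is void; [zeros s] lists the sets that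
    the bit sequence [s] declares to be hit, and [ones s] is the union of those
    that it declares to be void. *)
Section random_sets.
Context (R : realType) d (T : measurableType d) (mu : {measure set T -> \bar R}).
Variable W : nat -> set T.
Hypothesis mW : forall n, measurable (W n).
Hypothesis Woo : forall n, (mu (W n) < +oo)%E.

Fixpoint zeros s : seq (set T) :=
  if s is b :: s' then (if b then zeros s' else W (size s') :: zeros s')
  else [::].

Fixpoint ones s : set T :=
  if s is b :: s' then (if b then ones s' `|` W (size s') else ones s')
  else set0.

Definition void_prob (X : set T) : R := expR (- fine (mu X)).

Definition cell_prob s : R := altdiff void_prob (zeros s) (ones s).

Lemma zeros_nth s i : (i < size s)%N -> ~~ nth false (rev s) i ->
  W i \in zeros s.
Proof.
elim: s => //= b s IH; rewrite ltnS rev_cons nth_rcons size_rev leq_eqVlt.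
case: ltngtP => //= [lis _|-> _].
  by move=> /(IH lis) ?; case: b => //; rewrite inE orbC; apply/orP; left.
by case: b => // _; rewrite mem_head.
Qed.

Lemma ones_nth s i : (i < size s)%N -> nth false (rev s) i ->
  W i `<=` ones s.
Proof.
elim: s => //= b s IH; rewrite ltnS rev_cons nth_rcons size_rev leq_eqVlt.
case: ltngtP => //= [lis _|-> _].
  move=> /(IH lis) ?; case: b => //; exact: subset_trans (@subsetUl _ _ _).
by case: b => // _; exact: subsetUr.
Qed.

Lemma zerosP s X : X \in zeros s -> exists i, X = W i.
Proof.
elim: s => //= -[|] s IH // ; rewrite inE => /predU1P[->|//].
by exists (size s).
Qed.

Lemma onesP s : measurable (ones s) /\ (mu (ones s) < +oo)%E.
Proof.
elim: s => [|[|] s [IHm IHoo]] //=; first by rewrite measure0.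
split; first exact: measurableU.
apply: (le_lt_trans (measureU2 _ _ _)) => //.
by apply: lte_add_pinfty => //; exact: Woo.
Qed.

Lemma cell_prob_nil : cell_prob [::] = 1.
Proof. by rewrite /cell_prob /void_prob /= measure0/= oppr0 expR0. Qed.

Lemma cell_prob_ge0 s : 0 <= cell_prob s.
Proof.
have [? ?] := onesP s.
by apply: altdiff_expRN_measure_ge0 => // X /zerosP[i ->].
Qed.

Lemma cell_prob_split s :
  cell_prob s = cell_prob (true :: s) + cell_prob (false :: s).
Proof. by rewrite /cell_prob /= addrC subrK. Qed.

(** Descending induction on the number [size s] of bits that are already known.
    When all [n] bits are known, the events indexed by [A] either all hold on
    the cell of [s], or one of them fails and both sides vanish; revealing one
    more bit splits both sides in the same way. *)
Let lebesgue_bits (A : seq nat) n s : (forall i, i \in A -> i < n)%N ->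
    (size s <= n)%N ->
  lebesgue01 (cell cell_prob s `&` \bigcap_(i in [set` A]) bit cell_prob i) =
  (altdiff void_prob (zeros s) (ones s `|` \bigcup_(i in [set` A]) W i))%:E.
Proof.
have mA : measurable (\bigcap_(i in [set` A]) bit cell_prob i :
    set (measurableTypeR R)).
  apply: bigcap_measurableType => i _.
  exact: measurable_bit cell_prob_nil cell_prob_ge0 cell_prob_split i.
have mC s' := measurable_cell cell_prob_nil cell_prob_ge0 cell_prob_split s'.
move=> An; move: {2}(n - size s)%N (erefl (n - size s)%N) => k.
elim: k s => [|k IH] s.
  move/eqP; rewrite subn_eq0 => ns sn.
  have {ns sn}sn : size s = n by apply/anti_leq; rewrite ns sn.
  have [sA|] := pselect (forall i, i \in A -> nth false (rev s) i).
    rewrite (setUidl (_ : _ `<=` ones s)); last first.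
      by apply: bigcup_sub => i iA; apply: ones_nth; [rewrite sn An|exact: sA].
    rewrite setIidl ?lebesgue01_cell//.
    + exact: cell_prob_nil.
    + exact: cell_prob_ge0.
    + exact: cell_prob_split.
    move=> t [t01 ts] i /= iA; apply/(@bits_bit _ _ n) => //; first exact: An.
    by rewrite -sn ts sA.
  move/existsNP => [i /not_implyP[iA /negP si]].
  rewrite (@altdiff_eq0 _ _ _ _ _ (W i)); last 2 first.
  - by apply: zeros_nth => //; rewrite sn An.
  - by move=> x Wx; right; exists i.
  suff -> : cell cell_prob s `&` \bigcap_(i in [set` A]) bit cell_prob i = set0.
    exact: measure0.
  apply/seteqP; split => // t [[t01 ts] /(_ i iA)/(bits_bit _ t01 (An _ iA))].
  by rewrite -sn ts; apply/negP.
move=> nsk sn.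
have ltsn : (size s < n)%N by rewrite -subn_gt0 nsk.
have nsk' b : (n - size (b :: s) = k)%N by rewrite /= subnS nsk.
have -> : cell cell_prob s =
    cell cell_prob (true :: s) `|` cell cell_prob (false :: s).
  apply/seteqP; split=> t.
    move=> [t01 ts].
    case E : (t < lower cell_prob s + cell_prob (true :: s)); [left|right].
      by split => //=; rewrite ts E.
    by split => //=; rewrite ts E.
  by case=> -[t01 /=[_ ts]]; split.
rewrite setIUl measureU/=; last 3 first.
- exact: measurableI.
- exact: measurableI.
- rewrite setIACA (_ : cell _ _ `&` _ = set0) ?set0I//.
  by apply/seteqP; split=> t // [[_ /= [e _]] [_ /= []]]; rewrite e.
rewrite !IH// -EFinD; congr EFin; rewrite /= addrC.
by rewrite (setUAC (ones s)) subrK.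
Qed.

(** For the void events [E i] of the sets [W i] under a Poisson process of
    intensity [mu], the intersection of finitely many [E i] is the void event of
    the union of the corresponding [W i]. *)
Lemma exists_random_sets :
  exists d' (Omega : measurableType d') (P : probability Omega R)
    (E : nat -> set Omega), (forall n, measurable (E n)) /\
    forall A : seq nat, P (\bigcap_(i in [set` A]) E i) =
      (expR (- fine (mu (\bigcup_(i in [set` A]) W i))))%:E.
Proof.
exists _, _, (@lebesgue01 R), (bit cell_prob); split.
  exact: measurable_bit cell_prob_nil cell_prob_ge0 cell_prob_split.
move=> A; have An i : i \in A -> (i < (\max_(i <- A) i).+1)%N.
  by move=> iA; rewrite ltnS leq_bigmax_seq.
have := lebesgue_bits An (leq0n _ : size [::] <= _)%N.
rewrite set0U => <-; rewrite /lebesgue01 /mrestr; congr (lebesgue_measure _).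
apply/seteqP; split => t /=.
  by rewrite in_itv/= => -[tA t01].
by rewrite in_itv/= => -[[[t01 _] tA] _].
Qed.

End random_sets.

(** * Walks as lists of edges *)

Section walks.
Variable G : graph.
Implicit Types (u v w x : vertex G) (e : edge G) (es : seq (edge G)).

(** A walk given by its edges: whether the edges are open is then a finite
    conjunction of coordinates of the configuration. *)
Fixpoint trail es u v : Prop :=
  if es is e :: es' then exists2 w, ends e = [set u; w] & trail es' w v
  else u = v.

Definition all_in (S : set (edge G)) es := all (fun e => `[< S e >]) es.

Lemma walkP S n u v : walk S n u v <->
  exists es, [/\ size es = n, trail es u v & all_in S es].
Proof.
split.
  case=> p [pp <- <-] {v n}; elim: p u pp => [|x p IH] u /=.
    by move=> _; exists [::].
  case/andP=> /asboolP[e Se eux] /IH[es [<- tr Ses]].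
  by exists (e :: es); split => //=; [exists x|rewrite Ses andbT; apply/asboolP].
case=> es [<- tr Ses] {n}; elim: es u tr Ses => [|e es IH] u /=.
  by move=> -> _; exists [::].
case=> x eux /IH {}IH /andP[/asboolP Se /IH[p [pp <- <-]]].
exists (x :: p); split => //=; rewrite pp andbT; apply/asboolP.
by exists e.
Qed.

Lemma joinedP S u v : joined S u v <-> exists2 es, trail es u v & all_in S es.
Proof.
split=> [[n /walkP[es [_ tr Ses]]]|[es tr Ses]]; first by exists es.
by exists (size es); apply/walkP; exists es.
Qed.

Lemma trail_cat es1 es2 u v w : trail es1 u v -> trail es2 v w ->
  trail (es1 ++ es2) u w.
Proof.
elim: es1 u => [|e es1 IH] u /=; first by move=> ->.
by case=> x eux /IH{}IH /IH; exists x.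
Qed.

Lemma trail_rev es u v : trail es u v -> trail (rev es) v u.
Proof.
elim: es u => [|e es IH] u //=; case=> w euw /IH tr.
rewrite rev_cons -cats1; apply: (trail_cat tr) => /=.
by exists u; rewrite // setUC.
Qed.

Lemma joined_refl S u : joined S u u.
Proof. by apply/joinedP; exists [::]. Qed.

Lemma joined_sym S u v : joined S u v -> joined S v u.
Proof.
move=> /joinedP[es tr Ses]; apply/joinedP; exists (rev es).
  exact: trail_rev.
by rewrite /all_in all_rev.
Qed.

Lemma joined_trans S u v w : joined S u v -> joined S v w -> joined S u w.
Proof.
move=> /joinedP[es1 tr1 S1] /joinedP[es2 tr2 S2]; apply/joinedP.
exists (es1 ++ es2); first exact: trail_cat tr2.
by rewrite /all_in all_cat; apply/andP.
Qed.

Section connected.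
Hypothesis conn : connected_graph G.

Lemma walk_gdist u v : walk setT (gdist u v) u v.
Proof.
rewrite /gdist; case: pselect => [uv|].
  by case: ex_minnP => n /asboolP.
by case: (conn u v) => n uv []; exists n; apply/asboolP.
Qed.

Lemma gdist_le n u v : walk setT n u v -> (gdist u v <= n)%N.
Proof.
move=> uv; rewrite /gdist; case: pselect => // h.
by case: ex_minnP => m _; apply; apply/asboolP.
Qed.

Lemma gdist_ends e u v : ends e = [set u; v] -> (gdist u v <= 1)%N.
Proof.
move=> euv; apply: gdist_le; apply/walkP; exists [:: e]; split => //=.
  by exists v.
by rewrite andbT; apply/asboolP.
Qed.

Lemma gdist_eq0 u v : gdist u v = 0%N <-> u = v.
Proof.
split=> [uv|->].
  by have := walk_gdist u v; rewrite uv => /walkP[[|e es] [//= _ ->]].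
apply/eqP; rewrite -leqn0; apply: gdist_le.
by apply/walkP; exists [::].
Qed.

Lemma exists_gdist1 u v : u <> v ->
  exists (e : edge G) x y, ends e = [set x; y] /\ gdist x y = 1%N.
Proof.
move=> uv; have /walkP[es [sz tr _]] := walk_gdist u v.
elim: es u uv tr {sz} => [|e es IH] u uv //= [w euw tr].
have [uw|uw] := pselect (u = w); first by apply: IH tr; rewrite -uw.
exists e, u, w; split => //; apply/eqP; rewrite eqn_leq (gdist_ends euw)/=.
by rewrite lt0n; apply/eqP => /gdist_eq0.
Qed.

End connected.

Section countability.
Hypotheses (conn : connected_graph G) (locfin : locally_finite G).

Lemma finite_ends e : finite_set (ends e).
Proof. by have [u [v ->]] := endsP e; rewrite finite_setU. Qed.

(** Balls are finite, and they exhaust a connected graph. *)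
Lemma countable_vertex : countable [set: vertex G].
Proof.
have [->//|/set0P[x0 _]] := eqVneq [set: vertex G] set0.
pose ball n := iter n (fun B => \bigcup_(v in B)
  \bigcup_(e in [set e : edge G | ends e v]) ends e) [set x0].
have fin_ball n : finite_set (ball n).
  elim: n => [|n IH]; first exact: finite_set1.
  apply: bigcup_finite => // v _.
  by apply: bigcup_finite => // e _; exact: finite_ends.
apply: (@sub_countable _ _ _ (\bigcup_n ball n)); last first.
  by apply: bigcup_countable => // n _; exact: finite_set_countable.
apply: subset_card_le => v _.
have /joinedP[es tr _] := joined_sym (conn x0 v).
exists (size es) => //; elim: es v tr => [|e es IH] v //=.
case=> w evw /IH wb; exists w => //; exists e => /=; rewrite evw; first by right.
by left.
Qed.

Lemma countable_edge : countable [set: edge G].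
Proof.
apply: (@sub_countable _ _ _
  (\bigcup_(v in [set: vertex G]) [set e : edge G | ends e v])).
  apply: subset_card_le => e _; have [u [v euv]] := endsP e.
  by exists u => //=; rewrite euv; left.
apply: bigcup_countable; first exact: countable_vertex.
by move=> v _; exact/finite_set_countable/locfin.
Qed.

End countability.

End walks.

(** * Measurability on the space of configurations *)

Section configurations.
Variable G : graph.
Implicit Types (w : config G) (e : edge G) (es : seq (edge G)).

Lemma open_coord e : open [set w : {ptws edge G -> bool} | w e].
Proof.
have pe := @proj_continuous {classic (edge G)} (fun=> bool) e.
apply: (open_comp (f := fun w : {ptws edge G -> bool} => w e) (D := [set true])).
  by move=> w _; exact: pe.
exact: discrete_open.
Qed.

Lemma measurable_coord e :
  measurable ([set w | open_edges w e] : set (config G)).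
Proof. by apply: sub_sigma_algebra; exact: open_coord. Qed.

Lemma open_all_in es :
  open [set w : {ptws edge G -> bool} | all_in (open_edges (w : config G)) es].
Proof.
elim: es => [|e es IH].
  by rewrite (_ : [set _ | _] = setT); [exact: openT|apply/seteqP; split].
rewrite (_ : [set _ | _] = [set w : {ptws edge G -> bool} | w e] `&`
    [set w : {ptws edge G -> bool} | all_in (open_edges (w : config G)) es]).
  by apply: openI => //; exact: open_coord.
by apply/seteqP; split=> w /=; rewrite asboolb => /andP.
Qed.

(** The event is a union of open cylinders, one for each trail from [u] to [v]. *)
Lemma measurable_joined u v :
  measurable ([set w | joined (open_edges w) u v] : set (config G)).
Proof.
apply: sub_sigma_algebra.
rewrite (_ : [set _ | _] = \bigcup_(es in [set es | trail es u v])
   [set w : config G | all_in (open_edges w) es]).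
  by apply: (@bigcup_open {ptws edge G -> bool}) => es _; exact: open_all_in.
apply/seteqP; split=> w /=; first by move/joinedP=> [es]; exists es.
by case=> es tr Ses; apply/joinedP; exists es.
Qed.

Lemma open_cylinder (O : set {ptws edge G -> bool}) w : open O -> O w ->
  exists es, forall w', all_in [set e | w' e = w e] es -> O w'.
Proof.
pose F : set_system {ptws edge G -> bool} :=
  [set A | exists es, forall w', all_in [set e | w' e = w e] es -> A w'].
(* [F] converges to [w] in each coordinate, hence in the product topology. *)
have FF : Filter F.
  split.
  - by exists [::].
  - move=> A B [es1 h1] [es2 h2]; exists (es1 ++ es2) => w'.
    by rewrite /all_in all_cat => /andP[/h1 ? /h2 ?].
  - by move=> A B AB [es h]; exists es => w' /h /AB.
move=> oO Ow; suff : F --> (w : {ptws edge G -> bool}).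
  by apply; exact: open_nbhs_nbhs.
apply/cvg_sup => e U [V [[W] oW <-] Vw WU].
apply: (filterS WU); exists [:: e] => w' /=; rewrite andbT => /asboolP /= ee.
by rewrite /= ee.
Qed.

(** The Borel sets are generated by the coordinates: an open set is a union of
    finite cylinders, and with countably many edges there are only countably
    many of these. *)
Lemma measurable_config_map d (T : measurableType d) (f : T -> config G) :
  countable [set: edge G] ->
  (forall e, measurable [set t | open_edges (f t) e]) ->
  measurable_fun setT f.
Proof.
move=> /countable_injP[code codeI] mf.
have {}codeI e e' : code e = code e' -> e = e' by apply: codeI; rewrite inE.
apply: (@measurability _ _ T (config G) setT f (@open {ptws edge G -> bool})) => //.
move=> _ [Q oQ <-].
rewrite setTI.
pose cyl (s : seq (nat * bool)) : set (config G) :=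
  [set w | forall e b, (code e, b) \in s -> w e = b].
have -> : f @^-1` Q =
    \bigcup_s (if `[< cyl s `<=` Q >] then f @^-1` cyl s else set0).
  apply/seteqP; split=> [t Qft|t [s _]]; last by case: ifPn => // /asboolP h /h.
  have [es esQ] := open_cylinder oQ Qft.
  pose s := [seq (code e, f t e) | e <- es].
  have cs : cyl s (f t).
    rewrite /cyl/s /=; elim: (es) => //= e es' IH e' b.
    by rewrite inE => /predU1P[[/codeI -> ->]|/IH].
  exists s => //; rewrite ifT//; apply/asboolP => w sw; apply: esQ.
  move: sw; rewrite /s /cyl/=; elim: (es) => //= e es' IH sw; apply/andP; split.
    by apply/asboolP; apply: sw; rewrite mem_head.
  by apply: IH => e' b e'b; apply: sw; rewrite inE e'b orbT.
apply: countable_bigcupT_measurable; first exact: countableP.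
move=> s; case: ifP => // _.
elim: s => [|[n b] s IH].
  by rewrite (_ : _ @^-1` _ = setT)//; apply/seteqP; split => // t _ e b.
have -> : f @^-1` cyl ((n, b) :: s) =
    [set t | forall e, code e = n -> f t e = b] `&` f @^-1` cyl s.
  apply/seteqP; split=> t /=.
    move=> h; split=> [e en|e b' eb]; first by apply: h; rewrite en mem_head.
    by apply: h; rewrite inE eb orbT.
  by case=> h1 h2 e b'; rewrite inE => /predU1P[[/h1 -> ->]//|/h2].
apply: measurableI => //.
have [[e en]|ne] := pselect (exists e, code e = n); last first.
  rewrite (_ : [set _ | _] = setT)//; apply/seteqP; split => // t _ e en.
  by exfalso; apply: ne; exists e.
have -> : [set t | forall e, code e = n -> f t e = b] = [set t | f t e = b].
  apply/seteqP; split=> t /=; first exact.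
  by move=> h e'; rewrite -en => /codeI ->.
case: b; first exact: mf.
rewrite (_ : [set _ | _] = ~` [set t | f t e]); first exact/measurableC/mf.
by apply/seteqP; split=> t /=; [move=> ->|move/negP/negbTE].
Qed.

End configurations.

(** * Percolation from a measure on cuts *)

Lemma set2_inj (V : Type) (a b c d' : V) : [set a; b] = [set c; d'] ->
  (a = c /\ b = d') \/ (a = d' /\ b = c).
Proof.
move=> h.
have : [set c; d'] a by rewrite -h; left.
have : [set c; d'] b by rewrite -h; right.
have : [set a; b] c by rewrite h; left.
have : [set a; b] d' by rewrite h; right.
rewrite /= => -[] ? [] ? [] ? [] ?; subst; intuition.
Qed.

Lemma set_seq_cons (K : eqType) (x : K) s : [set` x :: s] = x |` [set` s].
Proof.
by apply/seteqP; split=> y /=; rewrite inE;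
  [move=> /predU1P|move=> ?; apply/predU1P].
Qed.

Section edge_ends.
Variables (G : graph) (e : edge G).

Definition end1 := sval (cid (endsP e)).
Definition end2 := sval (cid (svalP (cid (endsP e)))).

Lemma endsE : ends e = [set end1; end2].
Proof. by rewrite /end1 /end2; case: cid => u /= h; case: cid. Qed.

End edge_ends.

(** The measurable space [T] is a space of cuts, [half u] is the set of cuts that
    have [u] on their first side, and the wall between [u] and [v] is the set of
    cuts that separate [u] from [v]. *)
Section wall_percolation.
Context (R : realType) (G : graph) d (T : measurableType d).
Variable mu : {measure set T -> \bar R}.
Variable half : vertex G -> set T.
Hypotheses (conn : connected_graph G) (locfin : locally_finite G).

Local Notation wall u v := (half u `+` half v).

Hypothesis mhalf : forall u, measurable (half u).
Hypothesis wall_fin : forall u v, (mu (wall u v) < +oo)%E.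

Let mwall u v : measurable (wall u v).
Proof. by rewrite setY_def; apply: measurableU; exact: measurableD. Qed.

Let wall_trans u v w : wall u w `<=` wall u v `|` wall v w.
Proof.
rewrite !setY_def => x /= [[ux wx]|[wx ux]].
  by have [vx|vx] := pselect (half v x); [right|left]; left.
by have [vx|vx] := pselect (half v x); [left|right]; right.
Qed.

Let wall_ends e u v : ends e = [set u; v] -> wall (end1 e) (end2 e) = wall u v.
Proof.
by rewrite endsE => h; case: (set2_inj h) => -[-> ->] //; exact: setYC.
Qed.

(** Close every edge that is separated by a cut of a Poisson process of intensity
    [mu]. *)
Lemma wall_percolation : exists P : probability (config G) R,
  [/\ forall e u v, ends e = [set u; v] ->
        P [set w | open_edges w e] = (expR (- fine (mu (wall u v))))%:E,
      forall u v, (P [set w | joined (open_edges w) u v] <=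
        (expR (- fine (mu (wall u v))))%:E)%E &
      forall u v (L : R),
        (forall e x y, ends e = [set x; y] -> mu (wall x y) <= L%:E)%E ->
        ((expR (- (L * (gdist u v)%:R)))%:E <=
          P [set w | joined (open_edges w) u v])%E].
Proof.
have cV : countable [set: vertex G * vertex G].
  by rewrite -setXTT; apply: countableX; exact: countable_vertex.
have /countable_injP[code codeI] := cV.
have {}codeI x y : code x = code y -> x = y by apply: codeI; rewrite inE.
pose W n := \bigcup_(x in [set x | code x = n]) wall x.1 x.2.
have WE x : W (code x) = wall x.1 x.2.
  apply/seteqP; split=> [t [y /= /codeI ->]//|t xt].
  by exists x.
have Wn n : W n = set0 \/ exists x, n = code x.
  have [[x xn]|nx] := pselect (exists x, code x = n); [right|left].
    by exists x.
  by apply/seteqP; split=> // t [x xn]; case: nx; exists x.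
have mW n : measurable (W n).
  by have [->|[x ->]] := Wn n; rewrite ?WE.
have Woo n : (mu (W n) < +oo)%E.
  by have [->|[x ->]] := Wn n; rewrite ?WE ?measure0//; exact: wall_fin.
have [d' [D [P [E [mE PE]]]]] := exists_random_sets mW Woo.
pose idx e := code (end1 e, end2 e).
have Widx e : W (idx e) = wall (end1 e) (end2 e) by rewrite WE.
pose phi (t : D) : config G := fun e => `[< E (idx e) t >].
have phiE e : [set t | open_edges (phi t) e] = E (idx e).
  by apply/seteqP; split=> t /=; rewrite /open_edges/= /phi asboolE.
have mphi : measurable_fun setT phi.
  apply: measurable_config_map; first exact: countable_edge.
  by move=> e; rewrite phiE.
have mcap (s : seq nat) : measurable (\bigcap_(i in [set` s]) E i).
  exact: bigcap_measurableType.
have mcup (s : seq nat) : measurable (\bigcup_(i in [set` s]) W i).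
  exact: bigcup_measurable.
have PE1 i : P (E i) = (expR (- fine (mu (W i))))%:E.
  by have := PE [:: i]; rewrite set_cons1 bigcap_set1 bigcup_set1.
have phi_all t es : all_in (open_edges (phi t)) es <->
    (\bigcap_(i in [set` map idx es]) E i) t.
  elim: es => [|e es IH] /=; first by split => // _ i.
  rewrite set_seq_cons bigcap_setU1 -phiE; split.
    by case/andP=> /asboolP ? /IH.
  by case=> ? /IH ->; rewrite andbT; apply/asboolP.
have trail_wall es u v : trail es u v ->
    wall u v `<=` \bigcup_(i in [set` map idx es]) W i.
  elim: es u => [|e es IH] u /=; first by move=> ->; rewrite setYK.
  case=> w euw /IH wv; rewrite set_seq_cons bigcup_setU1 Widx (wall_ends euw).
  by move=> x /wall_trans -/(_ w)[?|/wv]; [left|right].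
pose Phi : {mfun D >-> config G} := mfun_Sub (mem_set mphi).
have mJ u v : measurable (Phi @^-1` [set w | joined (open_edges w) u v]).
  rewrite -[X in measurable X]setTI; apply: (mphi measurableT).
  exact: measurable_joined.
pose Q : probability (config G) R := distribution P Phi.
have QE S : Q S = P (Phi @^-1` S) by [].
exists Q; split.
- move=> e u v euv; transitivity (P (E (idx e))); first by rewrite -phiE.
  by rewrite PE1 Widx (wall_ends euv).
- move=> u v.
  set k := code (u, v).
  have Wk : W k = wall u v by rewrite WE.
  (* The events [B s] are null: if the walls listed in [s] are void and cover
     the wall of index [k], then this wall is void. Outside all of them, an open
     path from [u] to [v] implies [E k]. *)
  pose B (s : seq nat) := if `[< W k `<=` \bigcup_(i in [set` s]) W i >]
    then \bigcap_(i in [set` s]) E i `\` E k else set0.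
  have mB s : measurable (B s) by rewrite /B; case: ifP => // _; exact: measurableD.
  have B0 s : P (B s) = 0%E.
    rewrite /B; case: ifPn => [/asboolP Wks|_]; last exact: measure0.
    have := PE (k :: s); rewrite set_seq_cons bigcap_setU1 bigcup_setU1.
    rewrite (setUidr Wks) setIC => PEk.
    rewrite measureD//; last first.
      by rewrite (le_lt_trans (probability_le1 _ _))// ltry.
    rewrite -PE in PEk; rewrite [X in (_ - X)%E]PEk subee//.
    exact: fin_num_measure.
  pose N n := if unpickle n is Some s then B s else set0.
  have N0 : P.-negligible (\bigcup_n N n).
    apply: negligible_bigcup => n; rewrite /N; case: unpickle => [s|].
      by apply/negligibleP; [exact: mB|exact: B0].
    exact: negligible_set0.
  have Esub : Phi @^-1` [set w | joined (open_edges w) u v] `<=`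
      E k `|` \bigcup_n N n.
    move=> t /joinedP[es tr Ses]; have [?|nEk] := pselect (E k t); first by left.
    right; exists (pickle (map idx es)) => //; rewrite /N pickleK /B ifT.
      by split => //; exact/phi_all.
    by apply/asboolP; rewrite Wk; exact: trail_wall.
  have mN : measurable (\bigcup_n N n).
    by apply: bigcup_measurable => n _; rewrite /N; case: unpickle.
  rewrite -Wk -PE1; apply: (@le_trans _ _ (P (E k `|` \bigcup_n N n))).
    rewrite QE; apply: le_measure => //; rewrite inE//; exact: measurableU.
  apply: le_trans (measureU2 _ _ _) _ => //.
  by move/negligibleP : N0 => ->//; rewrite adde0.
- move=> u v L muL.
  have /walkP[es [<- tr _]] := walk_gdist conn u v.
  have muA : (mu (\bigcup_(i in [set` map idx es]) W i) <=
      (L * (size es)%:R)%:E)%E.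
    elim: (es) => [|e es' IH] /=.
      by rewrite set_nil bigcup_set0 measure0 mulr0.
    rewrite set_seq_cons bigcup_setU1 (le_trans (measureU2 _ _ _))//.
    rewrite -natr1 mulrDr mulr1 addrC EFinD leeD// Widx.
    exact: muL (endsE e).
  have subJ : \bigcap_(i in [set` map idx es]) E i `<=`
      Phi @^-1` [set w | joined (open_edges w) u v].
    by move=> t /phi_all Ses; apply/joinedP; exists es.
  apply: (@le_trans _ _ (P (\bigcap_(i in [set` map idx es]) E i))); last first.
    by rewrite QE; apply: le_measure; rewrite ?inE.
  rewrite PE lee_fin ler_expR lerN2 -lee_fin fineK//.
  by rewrite ge0_fin_numE// (le_lt_trans muA)// ltry.
Qed.

End wall_percolation.

(** * From embeddings to percolations *)

Section epigraph_walls.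
Context d (Y : measurableType d) (R : realType) (nu : {measure set Y -> \bar R}).

Definition epigraph (f : Y -> R) : set (Y * measurableTypeR R) :=
  [set p | f p.1 <= p.2].

Lemma measurable_epigraph (f : Y -> R) :
  measurable_fun setT f -> measurable (epigraph f).
Proof.
move=> mf; rewrite -[X in measurable X]setTI.
by apply: measurable_fun_le => //; exact: measurableT_comp.
Qed.

Lemma lebesgue_measure_setY_ray (a b : R) :
  lebesgue_measure (([set t | a <= t] : set (measurableTypeR R)) `+`
                    [set t | b <= t]) = `|a - b|%:E.
Proof.
wlog ab : a b / a <= b.
  move=> H; have [/H//|/ltW/H] := leP a b.
  by rewrite setYC distrC.
rewrite (_ : _ `+` _ = `[a, b[%classic); last first.
  rewrite setY_def; apply/seteqP; split=> t /=; rewrite in_itv/=.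
    case=> [[-> /negP]|[bt /negP]]; first by rewrite -ltNge.
    by rewrite (le_trans ab).
  by case/andP=> -> tb; left; split => //; apply/negP; rewrite -ltNge.
rewrite lebesgue_measure_itv/= lte_fin; case: ltP => [{}ab|ba].
  by rewrite distrC ger0_norm ?subr_ge0 ?ltW// EFinB.
have -> : a = b by apply/le_anti/andP.
by rewrite subrr normr0.
Qed.

(** The cuts of [Y * R] between [f] and [g]: over each [y], an interval of length
    [|f y - g y|]. *)
Lemma epigraph_wall_measure (f g : Y -> R) :
    measurable_fun setT f -> measurable_fun setT g ->
  (nu \x lebesgue_measure)%E (epigraph f `+` epigraph g) =
  ('N[nu]_1 [EFin \o (f \- g)%R])%E.
Proof.
move=> mf mg; rewrite Lnorm1 /product_measure1; apply: eq_integral => y _ /=.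
rewrite -lebesgue_measure_setY_ray; congr (lebesgue_measure _).
by apply/seteqP; split => t; rewrite /xsection/= inE.
Qed.

End epigraph_walls.

Lemma measurable_Lspace1 d (Y : measurableType d) (R : realType)
    (nu : {measure set Y -> \bar R}) (f : LspaceType1 nu) :
  measurable_fun setT (f : Y -> R).
Proof.
pose g : {mfun Y >-> measurableTypeR R} :=
  repr (f : {mfun_ nu, Y >-> measurableTypeR R}).
exact: (measurable_funPT g).
Qed.

Definition percolation_exponent (R : realType) (G : graph) (a : R) : Prop :=
  exists2 C : R, 0 < C &
    forall p : R, p < 1 ->
      exists2 P : probability (config G) R,
        (forall e : edge G, (p%:E < P [set w | open_edges w e])%E) &
        exists beta gamma : R,
          [/\ 0 < beta, 0 < gamma, beta / gamma <= C &
            forall u v : vertex G,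
              ((expR (- (beta * (gdist u v)%:R)))%:E
                 <= P [set w | joined (open_edges w) u v])%E /\
              (P [set w | joined (open_edges w) u v]
                 <= (expR (- (gamma * pow0 (gdist u v)%:R a)))%:E)%E].

(** With Lipschitz constant [L] and lower constant [c], intensity [eps] gives the
    rates [beta = eps * L] and [gamma = eps * c]. *)
Lemma percolation_of_compressible (R : realType) (G : graph) (a : R) :
  locally_finite G -> connected_graph G ->
  L1_compressible (fun u v : vertex G => (gdist u v)%:R : R) a ->
  percolation_exponent G a.
Proof.
move=> locfin conn [d [Y [nu [f [[L0 fL0] [c c0 fc]]]]]].
pose L := Num.max L0 1.
have L_gt0 : 0 < L by rewrite lt_max ltr01 orbT.
have fL u v : (L1dist (f u) (f v) <= (L * (gdist u v)%:R)%:E)%E.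
  by rewrite (le_trans (fL0 u v))// lee_fin ler_wpM2r// le_max lexx.
exists (L / c); first by rewrite divr_gt0.
move=> p p1.
(* Edges are open with probability at least [expR (- (eps * L))], hence at
   least [1 - eps * L = (1 + p) / 2]. *)
pose eps : R := (1 - p) / (2 * L).
have eps_gt0 : 0 < eps by rewrite divr_gt0 ?subr_gt0// mulr_gt0.
pose mu : {measure set (Y * measurableTypeR R) -> \bar R} :=
  mscale (NngNum (ltW eps_gt0)) (nu \x lebesgue_measure)%E.
pose half u := epigraph (f u).
have mf u : measurable_fun setT (f u : Y -> R) by exact: measurable_Lspace1.
have mhalf u : measurable (half u) by exact: measurable_epigraph.
have muE u v : mu (half u `+` half v) = (eps%:E * L1dist (f u) (f v))%E.
  by rewrite /L1dist -(@epigraph_wall_measure _ _ _ nu _ _ (mf u) (mf v)).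
have mu_le u v : (mu (half u `+` half v) <= (eps * L * (gdist u v)%:R)%:E)%E.
  rewrite muE -mulrA [leRHS]EFinM; apply: lee_wpmul2l; last exact: fL.
  by rewrite lee_fin ltW.
have mu_fin u v : (mu (half u `+` half v) < +oo)%E.
  by rewrite (le_lt_trans (mu_le u v))// ltry.
have mu_ge u v :
    eps * c * pow0 (gdist u v)%:R a <= fine (mu (half u `+` half v)).
  rewrite -lee_fin fineK ?ge0_fin_numE// muE -mulrA [leLHS]EFinM.
  by apply: lee_wpmul2l; [rewrite lee_fin ltW|exact: fc].
have mu_end e x y : ends e = [set x; y] ->
    (mu (half x `+` half y) <= (eps * L)%:E)%E.
  move=> /gdist_ends xy; rewrite (le_trans (mu_le x y))// lee_fin.
  by rewrite ler_piMr ?lern1// mulr_ge0// ltW.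
have [P [Pedge Ple Pge]] := wall_percolation conn locfin mhalf mu_fin.
exists P.
  move=> e; have [u [v euv]] := endsP e; rewrite (Pedge _ _ _ euv) lte_fin.
  apply: (@lt_le_trans _ _ (1 + (- (eps * L)))); last first.
    apply: le_trans (expR_ge1Dx _) _; rewrite ler_expR lerN2.
    by rewrite -lee_fin fineK ?ge0_fin_numE//; exact: mu_end euv.
  have -> : eps * L = (1 - p) / 2 by rewrite /eps; field; rewrite gt_eqF.
  by lra.
exists (eps * L), (eps * c); split; [exact: mulr_gt0|exact: mulr_gt0| |].
  by rewrite -mulf_div divff ?mul1r// gt_eqF.
move=> u v; split; first by apply: Pge => e x y; exact: mu_end.
apply: le_trans (Ple u v) _; rewrite lee_fin ler_expR lerN2.
exact: mu_ge.
Qed.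

(** * From percolations to embeddings *)

Section cut_embedding.
Context d (Y : measurableType d) (R : realType) (nu : {measure set Y -> \bar R}).

Let measurable_abse_EFin (f : Y -> R) : measurable_fun setT f ->
  measurable_fun setT (fun x => `|(f x)%:E|%E).
Proof. by move=> mf; apply: measurableT_comp => //; exact/measurable_EFinP. Qed.

Lemma Lspace1_of_mfun (h : {mfun Y >-> measurableTypeR R}) :
  (\int[nu]_x `|(h x)%:E| < +oo)%E ->
  exists F : LspaceType1 nu, {ae nu, forall x, (F : Y -> R) x = h x}.
Proof.
move=> hoo.
pose q : {mfun_ nu, Y >-> measurableTypeR R} :=
  (\pi_(aeEqMfun (measurableTypeR R) nu) h)%qT.
have qh : {ae nu, forall x, q x = h x}.
  have /eqmodP/asboolP : (repr q = h %[mod aeEqMfun (measurableTypeR R) nu])%qT.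
    by rewrite reprK.
  by apply: filterS => x /(_ I).
have mq : measurable_fun setT (q : Y -> R) by exact: (measurable_funPT (repr q)).
have mh : measurable_fun setT (h : Y -> R) by exact: (measurable_funPT h).
have qfin : finite_norm nu 1 (q : Y -> R).
  rewrite /finite_norm Lnorm1 (ge0_ae_eq_integral (g := fun x => `|(h x)%:E|%E))//.
  - exact: measurable_abse_EFin mq.
  - exact: measurable_abse_EFin mh.
  - by apply: filterS qh => x /= -> _.
pose F' := @isFinLebesgue.Build _ _ _ nu 1%E (lexx _) q qfin.
pose F : LspaceType1 nu := HB.pack q F'.
by exists F.
Qed.

Lemma integral_setY (A B : set Y) : measurable A -> measurable B ->
  (\int[nu]_x `|(\1_A x - \1_B x)%R%:E| = nu (A `+` B))%E.
Proof.
move=> mA mB; rewrite -[X in nu X]setIT -integral_indic//; last first.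
  by rewrite setY_def; apply: measurableU; exact: measurableD.
apply: eq_integral => x _; rewrite !indicE setY_def /=; congr EFin.
have [xA|xA] := boolP (x \in A); have [xB|xB] := boolP (x \in B);
  rewrite ?(subrr, subr0, sub0r, normr0, normrN, normr1).
- by rewrite memNset// => -[] [] _; apply; exact/set_mem.
- rewrite mem_set//=; left; split; first exact/set_mem.
  by move: xB; rewrite notin_setE.
- rewrite mem_set//=; right; split; first exact/set_mem.
  by move: xA; rewrite notin_setE.
- by move: xA xB; rewrite !notin_setE => xA xB; rewrite memNset// => -[] [].
Qed.

(** The indicators of the sets [A u] need not be integrable, but their differences
    are; so subtract the indicator of one fixed set. *)
Lemma cut_embedding (X : Type) (A : X -> set Y) :
  (forall u, measurable (A u)) -> (forall u v, nu (A u `+` A v) < +oo)%E ->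
  exists f : X -> LspaceType1 nu,
    forall u v, L1dist (f u) (f v) = nu (A u `+` A v).
Proof.
move=> mA Afin.
have [X0|/set0P[x0 _]] := eqVneq [set: X] set0.
  have noX (x : X) : False by rewrite -[False]/(set0 x) -X0.
  by exists (fun x => False_rect _ (noX x)) => u; case: (noX u).
have mh u : @measurable_fun _ _ Y (measurableTypeR R) setT
    (\1_(A u) \- \1_(A x0) : Y -> R).
  by apply: measurable_funB; exact: measurable_indic.
pose h u : {mfun Y >-> measurableTypeR R} :=
  @mfun_Sub _ _ Y (measurableTypeR R) _ (mem_set (mh u)).
have hE u x : h u x = \1_(A u) x - \1_(A x0) x by [].
have /choice[f fh] : forall u, exists F : LspaceType1 nu,
    {ae nu, forall x, (F : Y -> R) x = h u x}.
  move=> u; apply: Lspace1_of_mfun.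
  by under eq_integral do rewrite hE; rewrite integral_setY.
exists f => u v; rewrite /L1dist Lnorm1 -integral_setY//.
apply: ge0_ae_eq_integral => //.
- apply: measurable_abse_EFin; apply: measurable_funB; exact: measurable_Lspace1.
- apply: measurable_abse_EFin; apply: measurable_funB; exact: measurable_indic.
- apply: (filterS2 _ _ (fh u) (fh v)) => x /= -> -> _.
  by congr (`|_|%:E); ring.
Qed.

End cut_embedding.

Section percolation_embedding.
Context (R : realType) (G : graph) (P : nat -> probability (config G) R).
Hypotheses (conn : connected_graph G) (locfin : locally_finite G).
Implicit Types (u v : vertex G) (w : config G).
Variable c : nat -> {nonneg R}.

Let sep u v : set (config G) := [set w | ~ joined (open_edges w) u v].

Let sep_sym u v : sep u v = sep v u.
Proof. by apply/seteqP; split=> w h /joined_sym. Qed.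

Hypothesis sep_fin :
  forall u v, (\sum_(n <oo) (c n)%:num%:E * P n (sep u v) < +oo)%E.

(** A cluster is represented by the least code of its vertices. Up to a common
    translation, [u] is mapped to the indicator of the triples [(w, (n, k))] such
    that [k] represents the cluster of [u] in [w], for the measure that weights
    the law [P n] by [c n] and counts [k]. If [w] separates [u] from [v], the two
    indicators differ at [w] exactly for the two representatives, and otherwise
    nowhere. *)
Lemma percolation_embedding :
  exists (d : measure_display) (Y : measurableType d)
      (nu : {measure set Y -> \bar R}) (f : vertex G -> LspaceType1 nu),
    forall u v, L1dist (f u) (f v) =
      (2%:E * \sum_(n <oo) (c n)%:num%:E * P n (sep u v))%E.
Proof.
have /countable_injP[code codeI] := countable_vertex conn locfin.
have {}codeI x y : code x = code y -> x = y by apply: codeI; rewrite inE.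
pose hit u k : set (config G) :=
  [set w | exists2 v, code v = k & joined (open_edges w) u v].
have mhit u k : measurable (hit u k).
  have [[v vk]|nk] := pselect (exists v, code v = k).
    rewrite (_ : hit u k = [set w | joined (open_edges w) u v]).
      exact: measurable_joined.
    apply/seteqP; split=> w /=; last by exists v.
    by case=> v'; rewrite -vk => /codeI ->.
  rewrite (_ : hit u k = set0)//; apply/seteqP; split => // w [v vk].
  by case: nk; exists v.
(* [lead u k]: the least code in the cluster of [u] is [k]. *)
pose lead u := seqDU (hit u).
have mlead u k : measurable (lead u k) by exact: seqDU_measurable.
pose Y := (config G * (nat * nat))%type.
pose tag n k w : Y := (w, (n, k)).
have mtag n k : measurable_fun setT (tag n k) by exact: pair2_measurable.
pose Tag n k : {mfun config G >-> Y} := mfun_Sub (mem_set (mtag n k)).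
pose nuk n : {measure set Y -> \bar R} :=
  mseries (fun k => distribution (P n) (Tag n k)) 0.
pose nu : {measure set Y -> \bar R} := mseries (fun n => mscale (c n) (nuk n)) 0.
have nuE S : nu S = (\sum_(n <oo) (c n)%:num%:E *
    \sum_(k <oo) P n (tag n k @^-1` S))%E by [].
pose A u : set Y := [set y | lead u y.2.2 y.1].
have mA u : measurable (A u).
  have -> : A u = \bigcup_(nk : nat * nat)
      (lead u nk.2 `*` ([set nk.1] `*` [set nk.2])).
    apply/seteqP; split=> [[w [n k]] uk|]; first by exists (n, k).
    by move=> [w [n k]] [[n' k'] _ [/= h [-> ->]]].
  apply: countable_bigcupT_measurable => [|nk]; first exact: countableP.
  by apply: measurableX => //; exact: measurableX.
have nuD u v : nu (A u `\` A v) = (\sum_(n <oo) (c n)%:num%:E * P n (sep u v))%E.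
  rewrite nuE; apply: eq_eseriesr => n _; congr (_ * _)%E.
  rewrite -(@measure_semi_bigcup _ _ _ (P n) (fun k => lead u k `\` lead v k)).
  - congr (P n _); apply/seteqP; split=> [w [k _ [uk nvk] uv]|w uv].
      apply: nvk; move: uk; rewrite /lead /seqDU -!bigcup_mkord.
      move=> -[[x xk ux] no]; split.
        by exists x => //; exact: joined_trans (joined_sym uv) ux.
      case=> j jk [y yj vy]; apply: no; exists j => //; exists y => //.
      exact: joined_trans vy.
    have : (\bigcup_k hit u k) w.
      by exists (code u) => //; exists u => //; exact: joined_refl.
    rewrite seqDU_bigcup_eq => -[k _ uk]; exists k => //; split => // vk.
    have [x xk ux] := subset_seqDU uk; have [y yk vy] := subset_seqDU vk.
    move: yk; rewrite -xk => /codeI yx; apply: uv.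
    by apply: joined_trans ux _; rewrite -yx; exact: joined_sym.
  - by move=> k; exact: measurableD.
  - move=> i j _ _ [w [[ui _] [uj _]]].
    by apply: (@trivIset_seqDU _ (hit u)) => //; exists w.
  - by apply: bigcup_measurable => k _; exact: measurableD.
have nuY u v : nu (A u `+` A v) =
    (2%:E * \sum_(n <oo) (c n)%:num%:E * P n (sep u v))%E.
  transitivity (nu (A u `\` A v) + nu (A v `\` A u))%E.
    rewrite setY_def; apply: measureU; [exact: measurableD|exact: measurableD|].
    by apply/seteqP; split => // y [[? nv] [? _]].
  by rewrite !nuD (sep_sym v) mule_natl mule2n.
have Afin u v : (nu (A u `+` A v) < +oo)%E.
  by rewrite nuY lte_mul_pinfty.
have [f fE] := cut_embedding mA Afin.
by exists _, Y, nu, f => u v; rewrite fE nuY.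
Qed.

End percolation_embedding.

Section real_estimates.
Variable R : realType.
Implicit Types x delta : R.

Lemma dyadic_scale x : 1 <= x -> exists n, x <= 2 ^+ n <= 2 * x.
Proof.
move=> x1; have x0 : 0 <= x by exact: le_trans x1.
have ex : exists n, x <= 2 ^+ n.
  exists (Num.bound x); apply/ltW/(lt_le_trans (archi_boundP x0)).
  by rewrite -natrX ler_nat ltnW// ltn_expl.
exists (ex_minn ex); case: ex_minnP => -[|n] xn nmin; rewrite xn/=.
  by rewrite expr0 -[leLHS]mul1r ler_pM// ler1n.
rewrite exprS ler_pM2l// leNgt; apply/negP => /ltW /nmin.
by rewrite ltnn.
Qed.

(** At the scale [2 ^+ n ~ x], the weight [(2 `^ (- delta)) ^+ n] is of order
    [x `^ (- delta)]. *)
Lemma dyadic_weight x delta : 1 <= x -> 0 <= delta ->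
  exists2 n, x <= 2 ^+ n &
    (2 `^ (- delta)) * x `^ (- delta) <= (2 `^ (- delta)) ^+ n.
Proof.
move=> x1 delta0; have x0 : 0 < x by exact: lt_le_trans x1.
have [n /andP[xn nx]] := dyadic_scale x1; exists n => //.
have -> : (2 `^ (- delta)) ^+ n = (2 ^+ n) `^ (- delta) :> R.
  elim: (n) => [|k IH]; first by rewrite !expr0 powR1.
  by rewrite !exprS IH powRM.
rewrite -powRM ?(ltW x0)// !powRN lef_pV2 ?posrE ?powR_gt0 ?mulr_gt0 ?exprn_gt0//.
by apply: ge0_ler_powR; rewrite ?nnegrE ?mulr_ge0 ?exprn_ge0 ?(ltW x0).
Qed.

Lemma half_le_1BexpRN x : 0 <= x <= 1 -> x / 2 <= 1 - expR (- x).
Proof.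
case/andP=> x0 x1; rewrite expRN lerBrDl -lerBrDr.
apply: (@le_trans _ _ (1 + x)^-1).
  by rewrite lef_pV2 ?posrE ?expR_gt0 ?expR_ge1Dx// ltr_wpDr.
rewrite -[leLHS]mul1r ler_pdivrMr ?ltr_wpDr//.
have : 0 <= x * (1 - x) by rewrite mulr_ge0// subr_ge0.
by lra.
Qed.

Lemma nneseries_ge_term (u : nat -> \bar R) n : (forall k, 0 <= u k)%E ->
  (u n <= \sum_(k <oo) u k)%E.
Proof.
move=> u0; apply: le_trans (nneseries_lim_ge n.+1 _); last by [].
by rewrite big_nat_recr//= leeDr// sume_ge0.
Qed.

Lemma nneseries_le_geometric (u : nat -> \bar R) (K z : R) :
    0 <= K -> 0 < z < 1 -> (forall n, 0 <= u n <= (K * z ^+ n)%:E)%E ->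
  (\sum_(n <oo) u n <= (K * (1 - z)^-1)%:E)%E.
Proof.
move=> K0 /andP[z0 z1] uK.
have u0 n : (0 <= u n)%E by have /andP[] := uK n.
apply: lime_le; first by apply: is_cvg_nneseries => n _ _.
apply: nearW => n; apply: (@le_trans _ _ (series (geometric K z) n)%:E).
  rewrite /series/= -sumEFin; apply: lee_sum => k _.
  by have /andP[] := uK k.
by rewrite lee_fin geometric_le_lim// ger0_norm// ltW.
Qed.

End real_estimates.

Lemma probability_not_joined (R : realType) (G : graph)
    (P : probability (config G) R) u v :
  (P [set w | ~ joined (open_edges w) u v] =
   1 - P [set w | joined (open_edges w) u v])%E.
Proof.
rewrite -probability_setC; last exact: measurable_joined.
by congr (P _).
Qed.

(** The loss of the factor [1 - delta] is the price for a convergent sum over all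
    scales. *)
Lemma compressible_of_percolation (R : realType) (G : graph) (a delta : R) :
  locally_finite G -> connected_graph G ->
  0 <= a -> 0 < delta -> percolation_exponent G a ->
  L1_compressible (fun u v : vertex G => (gdist u v)%:R : R) (a * (1 - delta)).
Proof.
move=> locfin conn a0 delta0 [C C0 perc].
have p_lt1 n : expR (- (2 ^- n)) < 1 :> R.
  by rewrite expR_lt1 oppr_lt0 invr_gt0 exprn_gt0.
have /choice[P Pn] : forall n, exists P : probability (config G) R,
    (forall e : edge G,
      ((expR (- (2 ^- n)))%:E < P [set w | open_edges w e])%E) /\
    exists bg : R * R,
      [/\ 0 < bg.1, 0 < bg.2, bg.1 / bg.2 <= C &
        forall u v : vertex G,
          ((expR (- (bg.1 * (gdist u v)%:R)))%:E
             <= P [set w | joined (open_edges w) u v])%E /\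
          (P [set w | joined (open_edges w) u v]
             <= (expR (- (bg.2 * pow0 (gdist u v)%:R a)))%:E)%E].
  move=> n; have [P Pe [beta [gamma Pbg]]] := perc _ (p_lt1 n).
  by exists P; split => //; exists (beta, gamma).
have /choice[bg Pbg] n := (Pn n).2.
pose beta n := (bg n).1; pose gamma n := (bg n).2.
have beta0 n : 0 < beta n by have [] := Pbg n.
have gamma0 n : 0 < gamma n by have [] := Pbg n.
have betaC n : beta n / gamma n <= C by have [] := Pbg n.
have Plow n u v : ((expR (- (beta n * (gdist u v)%:R)))%:E
  <= P n [set w | joined (open_edges w) u v])%E.
  by have [_ _ _ /(_ u v)[]] := Pbg n.
have Pup n u v : (P n [set w | joined (open_edges w) u v]
  <= (expR (- (gamma n * pow0 (gdist u v)%:R a)))%:E)%E.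
  by have [_ _ _ /(_ u v)[]] := Pbg n.
pose r : R := 2 `^ (- delta).
have r0 : 0 < r by exact: powR_gt0.
have r1 : r < 1.
  rewrite /r /powR gt_eqF// expR_lt1 mulNr oppr_lt0 mulr_gt0// ln_gt0//.
  by rewrite ltr1n.
have c_ge0 n : 0 <= r ^+ n / gamma n.
  by rewrite divr_ge0 ?exprn_ge0 ?ltW.
pose c n := NngNum (c_ge0 n).
pose sep u v : set (config G) := [set w | ~ joined (open_edges w) u v].
have term_ge0 u v n : (0 <= (c n)%:num%:E * P n (sep u v))%E by exact: mule_ge0.
have term_le u v n :
    ((c n)%:num%:E * P n (sep u v) <= ((C * (gdist u v)%:R) * r ^+ n)%:E)%E.
  apply: (@le_trans _ _ ((c n)%:num%:E * (beta n * (gdist u v)%:R)%:E)%E).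
    apply: lee_wpmul2l; first by rewrite lee_fin.
    rewrite /sep probability_not_joined.
    apply: le_trans (leeB (lexx _) (Plow n u v)) _.
    rewrite -EFinB lee_fin lerBlDl -lerBlDr -[leLHS]/(1 + - _).
    exact: expR_ge1Dx.
  rewrite -EFinM lee_fin /=.
  have -> : r ^+ n / gamma n * (beta n * (gdist u v)%:R) =
      beta n / gamma n * ((gdist u v)%:R * r ^+ n) by ring.
  by rewrite -[leRHS]mulrA ler_wpM2r// mulr_ge0// exprn_ge0// ltW.
have sum_le u v : (\sum_(n <oo) (c n)%:num%:E * P n (sep u v) <=
    (C * (gdist u v)%:R * (1 - r)^-1)%:E)%E.
  apply: nneseries_le_geometric; first by rewrite mulr_ge0// ltW.
    by rewrite r0.
  by move=> n; rewrite term_ge0 term_le.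
have sum_fin u v : (\sum_(n <oo) (c n)%:num%:E * P n (sep u v) < +oo)%E.
  by rewrite (le_lt_trans (sum_le u v))// ltry.
have [d [Y [nu [f fE]]]] := percolation_embedding conn locfin sum_fin.
exists d, Y, nu, f; split.
  exists (2 * (C * (1 - r)^-1)) => u v; rewrite fE.
  have -> : 2 * (C * (1 - r)^-1) * (gdist u v)%:R =
    2 * (C * (gdist u v)%:R * (1 - r)^-1) by ring.
  by rewrite [leRHS]EFinM; apply: lee_wpmul2l; [rewrite lee_fin|exact: sum_le].
exists r => // u v; rewrite fE.
have [uv|uv] := pselect (u = v).
  rewrite /pow0 (gdist_eq0 conn u v).2// eqxx mulr0.
  apply: mule_ge0 => //.
  by apply: nneseries_ge0 => n _ _; exact: term_ge0.
(* For an edge with distinct ends, [expR (- gamma n)] bounds the probability of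
   connecting its ends, which exceeds [expR (- 2 ^- n)]. *)
have gamma_lt n : gamma n < 2 ^- n.
  have [e [x [y [exy dxy]]]] := exists_gdist1 conn uv.
  rewrite -ltrN2 -ltr_expR -lte_fin; apply: (lt_le_trans ((Pn n).1 e)).
  have := Pup n x y; rewrite dxy /pow0 oner_eq0 powR1 mulr1; apply: le_trans.
  apply: le_measure; rewrite ?inE; first exact: measurable_coord.
    exact: measurable_joined.
  move=> w ew; apply/joinedP; exists [:: e]; first by exists y.
  by rewrite /= andbT; apply/asboolP.
set D : R := (gdist u v)%:R.
have D1 : 1 <= D.
  by rewrite ler1n lt0n; apply/eqP => /(gdist_eq0 conn).
have Dneq0 : D != 0 by rewrite gt_eqF// (lt_le_trans ltr01).
have pow0E b : pow0 D b = D `^ b by rewrite /pow0 (negbTE Dneq0).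
have Da1 : 1 <= D `^ a.
  have := ge0_ler_powR a0 _ _ D1; rewrite powR1; by apply; rewrite nnegrE.
(* Keep only the term of the scale [n] of [D `^ a]; there
   [gamma n * D `^ a <= 1], so that [1 - expR (- _)] is almost linear. *)
have [n Dn rn] := dyadic_weight Da1 (ltW delta0).
rewrite pow0E.
apply: (@le_trans _ _ (2%:E * ((c n)%:num%:E * P n (sep u v)))%E); last first.
  apply: lee_wpmul2l; first by rewrite lee_fin.
  exact: (nneseries_ge_term (u := fun n => (c n)%:num%:E * P n (sep u v))%E).
apply: (@le_trans _ _ (2%:E *
  ((c n)%:num%:E * (gamma n * D `^ a / 2)%:E))%E); last first.
  apply: lee_wpmul2l; first by rewrite lee_fin.
  apply: lee_wpmul2l; first by rewrite lee_fin.
  rewrite /sep probability_not_joined.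
  apply: le_trans (leeB (lexx _) (Pup n u v)); rewrite -EFinB lee_fin pow0E.
  apply: half_le_1BexpRN; rewrite mulr_ge0 ?(ltW (gamma0 n)) ?powR_ge0//=.
  rewrite -[leRHS](@mulVf _ (2 ^+ n)) ?expf_neq0// ler_pM//.
  + exact: ltW.
  + exact: powR_ge0.
  + exact: ltW.
rewrite -!EFinM lee_fin /=.
have -> : 2 * (r ^+ n / gamma n * (gamma n * D `^ a / 2)) = D `^ a * r ^+ n.
  by move: (gamma n) (gamma0 n) (r ^+ n) => g /lt0r_neq0 g0 z; field.
rewrite mulrBr mulr1 powRD; last by rewrite Dneq0 implybT.
rewrite mulrCA ler_wpM2l ?powR_ge0//.
by rewrite -mulrN powRrM.
Qed.

(** * Comparison of the suprema *)

Lemma sup_unit_ge0 (R : realType) (S : set R) :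
  (forall x, S x -> 0 <= x <= 1) -> 0 <= sup S.
Proof.
move=> S01; have [->|/set0P[x Sx]] := eqVneq S set0; first by rewrite sup0.
have /andP[x0 _] := S01 x Sx; apply: (le_trans x0); apply: ub_le_sup => //.
by exists 1 => y /S01 /andP[].
Qed.

Lemma le_sup_unit (R : realType) (S : set R) (x : R) :
  (forall y, S y -> 0 <= y <= 1) -> S x -> x <= sup S.
Proof. by move=> S01 Sx; apply: ub_le_sup => //; exists 1 => y /S01 /andP[]. Qed.

Lemma sup_unit_le (R : realType) (S : set R) (x : R) :
  0 <= x -> (forall y, S y -> y <= x) -> sup S <= x.
Proof.
move=> x0 Sx; have [->|/set0P S0] := eqVneq S set0; first by rewrite sup0.
exact: ge_sup.
Qed.

Theorem theorem1p3 (R : realType) (G : graph)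
    (locfin : locally_finite G) (conn : connected_graph G) :
  graph_L1_compression_exponent R G =
  sup [set a : R | 0 <= a <= 1 /\
    exists2 C : R, 0 < C &
      forall p : R, p < 1 ->
        exists2 P : probability (config G) R,
          (forall e : edge G, (p%:E < P [set w | open_edges w e])%E) &
          exists beta gamma : R,
            [/\ 0 < beta, 0 < gamma, beta / gamma <= C &
              forall u v : vertex G,
                ((expR (- (beta * (gdist u v)%:R)))%:E
                   <= P [set w | joined (open_edges w) u v])%E /\
                (P [set w | joined (open_edges w) u v]
                   <= (expR (- (gamma * pow0 (gdist u v)%:R a)))%:E)%E]].
Proof.
rewrite /graph_L1_compression_exponent /L1_compression_exponent.
set A := [set a | _]; set B := [set a | _].
have A01 a : A a -> 0 <= a <= 1 by case.
have B01 a : B a -> 0 <= a <= 1 by case.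
apply/le_anti/andP; split; apply: sup_unit_le.
- exact: sup_unit_ge0.
- move=> a [a01 /(percolation_of_compressible locfin conn) aperc].
  by apply: le_sup_unit.
- exact: sup_unit_ge0.
- move=> a [/andP[a0 a1] aperc].
  have s0 := sup_unit_ge0 A01; set s := sup A in s0 *.
  rewrite leNgt; apply/negP => sa.
  have a_gt0 : 0 < a by exact: le_lt_trans sa.
  pose delta := (a - s) / (2 * a).
  have delta0 : 0 < delta by rewrite divr_gt0 ?subr_gt0 ?mulr_gt0.
  have as2 : a * (1 - delta) = (a + s) / 2.
    by rewrite /delta; field; exact: lt0r_neq0.
  (* [a * (1 - delta)] is the midpoint of [s] and [a], above the supremum. *)
  have : A (a * (1 - delta)).
    split; first by rewrite as2; apply/andP; split; lra.
    exact: compressible_of_percolation.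
  by move/(le_sup_unit A01); rewrite as2 -/s => ?; lra.
Qed.
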